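(* Let $P$ be a pattern whose first row, or last row, or first column, or last column consists only of $0$ entries. Then $sat(P,n)=\Theta(n)$.
   Context: All matrices are $0$-$1$ matrices; an $m\times n$ matrix has $m$ rows and $n$ columns. The weight of a matrix is its number of $1$ entries. A pattern is a $0$-$1$ matrix that is not all-zero. A matrix $M$ contains a $k\times l$ pattern $P$ if there are rows $r_1<\dots<r_k$ and columns $c_1<\dots<c_l$ of $M$ such that $M(r_a,c_b)=1$ whenever $P(a,b)=1$; otherwise $M$ avoids $P$. A matrix $M$ is saturating for $P$ if $M$ avoids $P$ and changing any single $0$ entry of $M$ to $1$ yields a matrix containing $P$. $sat(P,m,n)$ is the minimum weight of an $m\times n$ matrix saturating for $P$, and $sat(P,n)=sat(P,n,n)$. *)

(* Defs.v *)
From mathcomp Require Import all_boot all_algebra.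

Set Implicit Arguments.
Unset Strict Implicit.
Unset Printing Implicit Defensive.

Definition weight m n (M : 'M[bool]_(m, n)) : nat :=
  #|[set ij : 'I_m * 'I_n | M ij.1 ij.2]|.

Definition is_pattern k l (P : 'M[bool]_(k, l)) : bool :=
  P != const_mx false.

Definition increasing k m (r : {ffun 'I_k -> 'I_m}) : bool :=
  [forall a : 'I_k, forall b : 'I_k, (a < b) ==> (r a < r b)].

Definition contains k l m n (M : 'M[bool]_(m, n)) (P : 'M[bool]_(k, l)) : bool :=
  [exists r : {ffun 'I_k -> 'I_m}, exists c : {ffun 'I_l -> 'I_n},
    [&& increasing r, increasing c &
      [forall a : 'I_k, forall b : 'I_l, P a b ==> M (r a) (c b)]]].

Definition avoids k l m n (M : 'M[bool]_(m, n)) (P : 'M[bool]_(k, l)) : bool :=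
  ~~ contains M P.

Definition set_one m n (M : 'M[bool]_(m, n)) (i : 'I_m) (j : 'I_n) :
    'M[bool]_(m, n) :=
  \matrix_(a, b) (if (a == i) && (b == j) then true else M a b).

Definition saturating k l m n (P : 'M[bool]_(k, l)) (M : 'M[bool]_(m, n)) :
    bool :=
  avoids M P &&
  [forall i : 'I_m, forall j : 'I_n,
     (M i j == false) ==> contains (set_one M i j) P].

(* The default value m * n bounds every weight, so it never lowers the minimum;
   by sat_attained below the minimum is over a nonempty set as soon as P is not
   all-zero. *)
Definition sat k l (P : 'M[bool]_(k, l)) (m n : nat) : nat :=
  \big[minn/(m * n)%N]_(M : 'M[bool]_(m, n) | saturating P M) weight M.

Lemma weight_le m n (M : 'M[bool]_(m, n)) : weight M <= m * n.
Proof. by rewrite (leq_trans (max_card _)) // card_prod !card_ord. Qed.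

Lemma weight_set_one m n (M : 'M[bool]_(m, n)) i j :
  M i j = false -> weight M < weight (set_one M i j).
Proof.
move=> Mij; apply/proper_card/properP; split.
  by apply/subsetP => -[a b]; rewrite !inE /= mxE => ->; case: ifP.
by exists (i, j); rewrite !inE /= ?mxE ?eqxx ?Mij.
Qed.

Lemma saturating_exists k l (P : 'M[bool]_(k, l)) m n :
  is_pattern P -> exists M : 'M[bool]_(m, n), saturating P M.
Proof.
move=> Ppat.
have av0 : avoids (const_mx false : 'M[bool]_(m, n)) P.
  apply/negP => /existsP[r /existsP[c /and3P[_ _ /forallP H]]].
  move/eqP: Ppat; apply; apply/matrixP => a b; rewrite mxE.
  by apply/negP => Pab; have /forallP/(_ b) := H a; rewrite Pab mxE.
case: (@arg_maxnP _ (const_mx false : 'M[bool]_(m, n))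
         (fun M => avoids M P) (@weight m n) av0) => M avM maxM.
exists M; rewrite /saturating avM /=.
apply/forallP => i; apply/forallP => j; apply/implyP => /eqP Mij.
case: (boolP (contains (set_one M i j) P)) => // avM'.
by have := maxM _ avM'; rewrite /= leqNgt weight_set_one.
Qed.

Lemma sat_le k l (P : 'M[bool]_(k, l)) m n (M : 'M[bool]_(m, n)) :
  saturating P M -> sat P m n <= weight M.
Proof.
move=> satM; rewrite /sat; have := mem_index_enum M.
elim: (index_enum _) => [//|M' s IHs].
rewrite inE big_cons => /orP[/eqP <-|/IHs le_s].
  by rewrite satM geq_minl.
by case: ifP => // _; rewrite geq_min le_s orbT.
Qed.

Lemma sat_attained k l (P : 'M[bool]_(k, l)) m n :
  is_pattern P ->
  exists2 M : 'M[bool]_(m, n), saturating P M & weight M = sat P m n.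
Proof.
move=> /(saturating_exists m n)[M0 sat0].
case: (@arg_minnP _ M0 (saturating P) (@weight m n) sat0) => M satM minM.
exists M => //; apply/eqP; rewrite eqn_leq sat_le // andbT /sat.
apply: (big_ind (fun w => weight M <= w)); first exact: weight_le.
  by move=> x y Hx Hy; rewrite leq_min Hx Hy.
by move=> M' /minM.
Qed.

(* Main.v *)
(** Lower bound: a cell in the first row of [M] can only play the role of an
    entry in the first row of [P]. If that row is zero, setting such a cell to
    1 never creates [P], so every saturating matrix has a full first row; the
    three other borders are symmetric.

    Upper bound: pick any 1 entry [(a, b)] of [P], repeat row [a] and column
    [b] of [P] until the size is [n x n], and erase the block of copies of
    [(a, b)]. In a copy of [P], row [a] would have to lie among the repeated
    rows, each of which has one 1 less than row [a] of [P]: so the matrix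
    avoids [P]. Setting any cell of the erased block creates [P], hence an
    avoiding matrix of maximal weight above it is saturating and vanishes on
    that block, whose complement consists of a bounded number of lines. *)
Require Import Defs.
From mathcomp Require Import all_boot all_order all_algebra zify.

Set Implicit Arguments.
Unset Strict Implicit.
Unset Printing Implicit Defensive.

(** * Increasing maps and containment *)

Lemma increasingP k m (r : {ffun 'I_k -> 'I_m}) :
  reflect (forall a b : 'I_k, a < b -> r a < r b) (increasing r).
Proof.
apply: (iffP forallP) => [H a b ab|H a].
  by move/forallP/(_ b)/implyP: (H a); apply.
by apply/forallP => b; apply/implyP; apply: H.
Qed.

Lemma containsP k l m n (M : 'M[bool]_(m, n)) (P : 'M[bool]_(k, l)) :
  reflect (exists r : {ffun 'I_k -> 'I_m}, exists c : {ffun 'I_l -> 'I_n},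
             [/\ increasing r, increasing c &
                 forall a b, P a b -> M (r a) (c b)])
          (contains M P).
Proof.
apply: (iffP existsP) => [[r /existsP[c /and3P[Hr Hc /forallP H]]]|].
  by exists r, c; split=> // a b Pab; move/forallP/(_ b)/implyP: (H a); apply.
move=> [r [c [Hr Hc H]]]; exists r; apply/existsP; exists c; rewrite Hr Hc /=.
by apply/forallP => a; apply/forallP => b; apply/implyP; apply: H.
Qed.

Lemma contains_le k l m n (P : 'M[bool]_(k, l)) (M N : 'M[bool]_(m, n)) :
  (forall i j, M i j -> N i j) -> contains M P -> contains N P.
Proof.
move=> MN /containsP[r [c [Hr Hc H]]]; apply/containsP; exists r, c.
by split=> // a b /H /MN.
Qed.

Lemma increasing_geq k m (r : {ffun 'I_k -> 'I_m}) (a : 'I_k) :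
  increasing r -> a <= r a.
Proof.
move=> /increasingP incr; case: a => a; elim: a => [//|a IHa] lt_a /=.
have lt_a' : a < k by apply: ltnW.
by apply: leq_ltn_trans (IHa lt_a') _; apply: incr.
Qed.

Lemma increasing_leq k m (r : {ffun 'I_k -> 'I_m}) (a : 'I_k) :
  increasing r -> r a + k <= m + a.
Proof.
move=> /increasingP incr.
(* [d] counts the indices after [a]; the induction on it starts at the last index. *)
have [d def_d] : exists d, d + a.+1 = k.
  by exists (k - a.+1); rewrite subnK.
elim: d a def_d => [|d IHd] a def_d; first by have := ltn_ord (r a); lia.
have lt_a : a.+1 < k by lia.
have := IHd (Ordinal lt_a); have := incr a (Ordinal lt_a) => /=; lia.
Qed.

(** * Lower bound: a full border line *)

(** If [M i j] were 0, the copy of [P] created by setting it to 1 would meet [(i, j)] only in 0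
    entries of [P], so it would already be a copy in [M]. *)
Lemma saturating_useless_entry k l m n (P : 'M[bool]_(k, l))
    (M : 'M[bool]_(m, n)) (i : 'I_m) (j : 'I_n) :
  saturating P M ->
  (forall (r : {ffun 'I_k -> 'I_m}) (c : {ffun 'I_l -> 'I_n}) a b,
     increasing r -> increasing c -> r a = i -> c b = j -> P a b = false) ->
  M i j.
Proof.
move=> satM useless; apply/negPn/negP => /negbTE Mij.
case/andP: satM => /negP avM /forallP/(_ i)/forallP/(_ j).
rewrite Mij => /containsP[r [c [Hr Hc H]]]; apply: avM.
apply/containsP; exists r, c; split=> // a b Pab; have := H a b Pab.
rewrite mxE; case: ifP => // /andP[/eqP ra /eqP cb] _.
by rewrite (useless _ _ _ _ Hr Hc ra cb) in Pab.
Qed.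

Lemma weight_full_row m n (M : 'M[bool]_(m, n)) (i : 'I_m) :
  (forall j, M i j) -> n <= weight M.
Proof.
move=> Mi; rewrite -[X in X <= _]card_ord -cardsT.
rewrite -(card_imset [set: 'I_n] (f := fun j => (i, j))); last by move=> x y [].
by apply/subset_leq_card/subsetP => _ /imsetP[j _ ->]; rewrite inE Mi.
Qed.

Lemma weight_full_col m n (M : 'M[bool]_(m, n)) (j : 'I_n) :
  (forall i, M i j) -> m <= weight M.
Proof.
move=> Mj; rewrite -[X in X <= _]card_ord -cardsT.
rewrite -(card_imset [set: 'I_m] (f := fun i => (i, j))); last by move=> x y [].
by apply/subset_leq_card/subsetP => _ /imsetP[i _ ->]; rewrite inE Mj.
Qed.

Lemma row_const_false k l (P : 'M[bool]_(k, l)) a b :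
  row a P = const_mx false -> P a b = false.
Proof. by move=> /rowP/(_ b); rewrite !mxE. Qed.

Lemma col_const_false k l (P : 'M[bool]_(k, l)) a b :
  col b P = const_mx false -> P a b = false.
Proof. by move=> /colP/(_ a); rewrite !mxE. Qed.

Lemma increasing_eq0 k m (r : {ffun 'I_k.+1 -> 'I_m.+1}) a :
  increasing r -> r a = ord0 -> a = ord0.
Proof.
move=> Hr ra; apply: val_inj => /=.
by have := increasing_geq a Hr; rewrite ra /=; lia.
Qed.

Lemma increasing_eq_max k m (r : {ffun 'I_k.+1 -> 'I_m.+1}) a :
  increasing r -> r a = ord_max -> a = ord_max.
Proof.
move=> Hr ra; apply: val_inj => /=; have := ltn_ord a.
by have := increasing_leq a Hr; rewrite ra /=; lia.
Qed.

Lemma weight_saturating_ge k l (P : 'M[bool]_(k.+1, l.+1)) n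
    (M : 'M[bool]_(n, n)) :
  row ord0 P = const_mx false \/ row ord_max P = const_mx false \/
  col ord0 P = const_mx false \/ col ord_max P = const_mx false ->
  saturating P M -> n <= weight M.
Proof.
case: n M => [//|n] M zeroP satM.
case: zeroP => [P0|[P0|[P0|P0]]].
- apply: (@weight_full_row _ _ M ord0) => j.
  apply: (saturating_useless_entry satM) => r c a b Hr _ ra _.
  by rewrite (increasing_eq0 Hr ra) row_const_false.
- apply: (@weight_full_row _ _ M ord_max) => j.
  apply: (saturating_useless_entry satM) => r c a b Hr _ ra _.
  by rewrite (increasing_eq_max Hr ra) row_const_false.
- apply: (@weight_full_col _ _ M ord0) => i.
  apply: (saturating_useless_entry satM) => r c a b _ Hc _ cb.
  by rewrite (increasing_eq0 Hc cb) col_const_false.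
- apply: (@weight_full_col _ _ M ord_max) => i.
  apply: (saturating_useless_entry satM) => r c a b _ Hc _ cb.
  by rewrite (increasing_eq_max Hc cb) col_const_false.
Qed.

(** * Repeating one index of an interval *)

Section Collapse.

Variables (k n : nat) (a : 'I_k.+1).
Hypothesis le_kn : k < n.

(** The possible images of [a] under increasing maps: [a] indices must fit before [i] and [k - a]
    after it. *)
Definition middle (i : 'I_n) : bool := (a <= i) && (i + k.+1 <= n + a).

(* The nondecreasing surjection from ['I_n] onto ['I_k.+1] for which only [a] has
   more than one preimage. *)
Definition collapse (i : 'I_n) : 'I_k.+1 :=
  if i < a then inord i else if i + k.+1 <= n + a then a
  else inord (i + k.+1 - n).

Lemma val_collapse i :
  collapse i = (if i < a then i : nat else if i + k.+1 <= n + a then a : nat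
                else i + k.+1 - n) :> nat.
Proof.
rewrite /collapse; have := ltn_ord a; have := ltn_ord i => lt_i lt_a.
by do 2?[case: ifP => //] => *; rewrite inordK //; lia.
Qed.

Lemma collapse_eq i : (collapse i == a) = middle i.
Proof.
rewrite -val_eqE /= val_collapse /middle; have := ltn_ord i; have := ltn_ord a.
by do 2?[case: ifP => //] => *; lia.
Qed.

Lemma collapse_inj i j : collapse i != a -> collapse i = collapse j -> i = j.
Proof.
rewrite collapse_eq /middle => mid_i /(congr1 val) /=; rewrite !val_collapse.
move=> eq_ij; apply: val_inj => /=; move: eq_ij mid_i.
have := ltn_ord i; have := ltn_ord j; have := ltn_ord a.
by do 4?[case: ifP => //] => *; lia.
Qed.

Lemma collapse_section i :
  middle i ->
  exists r : {ffun 'I_k.+1 -> 'I_n},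
    [/\ increasing r, r a = i & forall x, collapse (r x) = x].
Proof.
have pos_n : 0 < n by lia.
move=> /andP[ge_i le_i].
(* The only freedom is the image of [a], taken to be [i]: smaller indices stay in place, larger ones
   are aligned with the end of ['I_n]. *)
pose f (x : 'I_k.+1) : nat :=
  if x < a then x : nat else if x == a then i : nat else n + x - k.+1.
have f_lt x : f x < n.
  rewrite /f; have := ltn_ord x; have := ltn_ord i; have := ltn_ord a.
  by do 2?[case: ifP => //] => *; lia.
have fE x : f x = if x < a then x : nat else if x == a :> nat then i : nat
                  else n + x - k.+1 by [].
pose r := [ffun x => Ordinal (f_lt x)].
exists r; split.
- apply/increasingP => x y lt_xy; rewrite !ffunE /= !fE.
  have := ltn_ord y; have := ltn_ord i; have := ltn_ord a.
  by do 4?[case: ifP => //] => *; lia.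
- by apply: val_inj; rewrite ffunE /= fE ltnn eqxx.
- move=> x; apply: val_inj; rewrite /= val_collapse ffunE /= fE.
  have := ltn_ord x; have := ltn_ord i; have := ltn_ord a.
  by do 4?[case: ifP => //] => *; lia.
Qed.

Lemma increasing_middle (r : {ffun 'I_k.+1 -> 'I_n}) :
  increasing r -> middle (r a).
Proof. by move=> Hr; rewrite /middle increasing_geq // increasing_leq. Qed.

(** [collapse] is injective outside the middle and misses [a] there, which leaves [k] values. *)
Lemma card_not_middle : #|[set i | ~~ middle i]| <= k.
Proof.
rewrite -(card_in_imset (f := collapse)); last first.
  by move=> i j; rewrite !inE -collapse_eq => Hi _; apply: collapse_inj.
have card_a : #|[set~ a]| = k by rewrite cardsC1 card_ord.
rewrite -[X in _ <= X]card_a; apply/subset_leq_card/subsetP => _ /imsetP[i Hi ->].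
by move: Hi; rewrite !inE collapse_eq.
Qed.

End Collapse.

(** * Upper bound: the blown-up pattern with an erased block *)

Section UpperBound.

Variables (k l m n : nat) (P : 'M[bool]_(k.+1, l.+1)).
Variables (a : 'I_k.+1) (b : 'I_l.+1).
Hypotheses (Pab : P a b) (le_km : k < m) (le_ln : l < n).

Definition blowup : 'M[bool]_(m, n) :=
  \matrix_(i, j) (P (collapse a i) (collapse b j) &&
                  ~~ (middle a i && middle b j)).

Lemma blowup_avoids : avoids blowup P.
Proof.
apply/negP => /containsP[r [c [Hr Hc H]]].
have mid_ra := increasing_middle a Hr.
(* Row [a] lands in a middle row, so its 1 entries must land outside the erased columns. *)
have inner y : P a y -> P a (collapse b (c y)) /\ collapse b (c y) != b.
  move=> /H; rewrite mxE mid_ra /= -(collapse_eq b le_ln).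
  by move: mid_ra; rewrite -collapse_eq // => /eqP -> /andP[].
pose S := [set y | P a y].
(* Collapsing the columns of the copy would inject the 1 entries of row [a] into those other than
   [b], although [b] is one of them. *)
suff : #|S| <= #|S :\ b|.
  by rewrite [#|S|](cardsD1 b) inE Pab add1n ltnn.
rewrite -(card_in_imset (f := fun y => collapse b (c y)) (D := S)).
  apply/subset_leq_card/subsetP => _ /imsetP[y Sy ->].
  by rewrite !inE in Sy *; have [-> ->] := inner y Sy.
move=> y z; rewrite !inE => /inner[_ Hy] _ /(collapse_inj le_ln Hy) eq_c.
move/increasingP: Hc => Hc; apply: val_inj => /=.
by case: (ltngtP y z) => // /Hc; rewrite eq_c ltnn.
Qed.

(** Sections of the two collapses through [i] and [j] give a copy of [P] that meets the erased block
    only at [(i, j)], the image of [(a, b)]. *)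
Lemma blowup_set_one i j :
  middle a i -> middle b j -> contains (set_one blowup i j) P.
Proof.
move=> mid_i mid_j; apply/containsP.
have [r [Hr ra rK]] := collapse_section le_km mid_i.
have [c [Hc cb cK]] := collapse_section le_ln mid_j.
exists r, c; split=> // x y Pxy; rewrite !mxE rK cK Pxy /=.
rewrite -!collapse_eq // rK cK; case: (x =P a) => [->|_]; last by case: ifP.
by case: (y =P b) => [->|_]; [rewrite ra cb !eqxx | case: ifP].
Qed.

Lemma weight_zero_block (M : 'M[bool]_(m, n)) :
  (forall i j, middle a i -> middle b j -> M i j = false) ->
  weight M <= k * n + m * l.
Proof.
move=> M0; set X := [set i : 'I_m | ~~ middle a i].
set Y := [set j : 'I_n | ~~ middle b j].
have sub : [set ij : 'I_m * 'I_n | M ij.1 ij.2] \subset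
           setX X [set: 'I_n] :|: setX [set: 'I_m] Y.
  apply/subsetP => -[i j]; rewrite !inE /= andbT.
  apply: contraTT; rewrite negb_or !negbK => /andP[mi mj].
  by rewrite M0.
apply: leq_trans (subset_leq_card sub) _.
apply: leq_trans (leq_card_setU _ _) _.
rewrite !cardsX !cardsT !card_ord.
by rewrite leq_add // leq_mul // card_not_middle.
Qed.

Lemma sat_le_lines : sat P m n <= k * n + m * l.
Proof.
(* A heaviest avoiding matrix above [blowup] is saturating, since setting one more 1 keeps it above
   [blowup]. *)
pose above (M : 'M[bool]_(m, n)) :=
  avoids M P && [forall i, forall j, blowup i j ==> M i j].
have above0 : above blowup.
  rewrite /above blowup_avoids; apply/forallP => i; apply/forallP => j.
  exact: implybb.
case: (@arg_maxnP _ blowup above (@weight m n) above0) => M /andP[avM leM] maxM.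
have {}leM i j : blowup i j -> M i j.
  by move/forallP/(_ i)/forallP/(_ j)/implyP: leM; apply.
apply: (@leq_trans (weight M)).
  apply: sat_le; rewrite /saturating avM; apply/forallP => i; apply/forallP => j.
  apply/implyP => /eqP Mij; case: (boolP (contains _ P)) => // av1.
  suff /maxM : above (set_one M i j) by rewrite /= leqNgt weight_set_one.
  rewrite /above /avoids av1; apply/forallP => x; apply/forallP => y.
  by apply/implyP => /leM Mxy; rewrite mxE Mxy; case: ifP.
apply: weight_zero_block => i j mid_i mid_j.
(* A 1 of [M] in the erased block would put [M] above [set_one blowup i j], which contains [P]. *)
apply/negP => Mij; move/negP: avM; apply.
apply: contains_le (blowup_set_one mid_i mid_j) => x y.
by rewrite mxE; case: ifP => [/andP[/eqP-> /eqP->]|_ /leM].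
Qed.

End UpperBound.

(** * Linear bounds and their asymptotic form *)

Lemma sat_linear_le k l (P : 'M[bool]_(k.+1, l.+1)) n :
  is_pattern P -> sat P n n <= (k + l) * n.
Proof.
move=> Ppat; have [M _ wM] := sat_attained n n Ppat.
have le_nn : sat P n n <= n * n by rewrite -wM weight_le.
have [le_nk|lt_kn] := leqP n k; first nia.
have [le_nl|lt_ln] := leqP n l; first nia.
have [a [b Pab]] : exists a b, P a b.
  suff /existsP[a /existsP[b Pab]] : [exists a, exists b, P a b] by exists a, b.
  apply: contraNT Ppat => /existsPn P0; apply/eqP/matrixP => a b; rewrite mxE.
  by have /existsPn/(_ b)/negbTE := P0 a.
by rewrite mulnDl [l * n]mulnC (sat_le_lines Pab).
Qed.

Lemma sat_linear_ge k l (P : 'M[bool]_(k.+1, l.+1)) n :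
  is_pattern P ->
  row ord0 P = const_mx false \/ row ord_max P = const_mx false \/
  col ord0 P = const_mx false \/ col ord_max P = const_mx false ->
  n <= sat P n n.
Proof.
move=> Ppat zeroP; have [M satM <-] := sat_attained n n Ppat.
exact: weight_saturating_ge zeroP satM.
Qed.

From mathcomp Require Import all_classical all_reals all_analysis.
Import GRing.Theory Num.Theory numFieldNormedType.Exports.
Local Open Scope classical_set_scope.
Local Open Scope ring_scope.

Theorem theorem4 (R : realType) (k l : nat) (P : 'M[bool]_(k.+1, l.+1)) :
  is_pattern P ->
  row ord0 P = const_mx false \/ row ord_max P = const_mx false \/
  col ord0 P = const_mx false \/ col ord_max P = const_mx false ->
  (fun n : nat => (sat P n n)%:R : R^o) =Theta_\oo (fun n : nat => n%:R : R^o).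
Proof.
move=> Ppat zeroP; rewrite eqThetaE bigThetaE eqOmegaO; split; apply/eqO_exP.
  (* The successor makes the constant visibly positive. *)
  exists (k + l).+1%:R; first by rewrite ltr0n.
  apply: filterE => n; rewrite !normr_nat -natrM ler_nat.
  by rewrite (leq_trans (sat_linear_le n Ppat)) // leq_mul2r leqnSn orbT.
exists 1 => //; apply: filterE => n.
by rewrite mul1r !normr_nat ler_nat sat_linear_ge.
Qed.
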